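(* Consider a Multimode Stochastic Shortest Path problem (MSSP) on $X=\{x_1,\dots,x_M,t\}$. (1) If every mode $m\in\mathcal M(x)$ of every node $x\in X\setminus\{t\}$ is absolutely causal, then the MSSP is absolutely causal and the Dijkstra-like method is applicable. (2) If each mode $m$ of each node is absolutely $\delta_m$-causal (with $\delta_m\ge 0$), then the MSSP is absolutely $\Delta$-causal with $$\Delta=\min_{x\in X\setminus\{t\},\ m\in\mathcal M(x)}\delta_m,$$ and the Dial-like method with buckets of width $\Delta$ is applicable if $\Delta>0$.
   Context: Notation: $\Xi_n=\{\xi\in\mathbb R^n:\xi_1+\dots+\xi_n=1,\ \xi_j\ge 0\ \forall j\}$; $\mathbb R^n_{+,0}=\{x\in\mathbb R^n: x_j\ge 0\ \forall j\}$. MSSP. $X=\{x_1,\dots,x_M,t\}$ is a finite state space with absorbing, cost-free target $t$. Each $x_i\ne t$ has a finite nonempty list $\mathcal M(x_i)$ of modes; each mode $m$ is a nonempty ordered set $m=(z^m_1,\dots,z^m_{|m|})$ of distinct elements of $X\setminus\{x_i\}$. The controls available at $x_i$ are exactly the pairs $a=(m,\xi)$ with $m\in\mathcal M(x_i)$ and $\xi\in\Xi_{|m|}$. Under control $(m,\xi)$ the process moves from $x_i$ to $z^m_j$ with probability $\xi_j$ (and to any state outside $m$ with probability $0$), and the transition cost is $C^m(x_i,\xi)$, where $\xi\mapsto C^m(x_i,\xi)$ is positive and continuous on $\Xi_{|m|}$. There is a constant $\kappa$ with $\sum_{m\in\mathcal M(x_i)}|m|\le\kappa$ for all $i$. Write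 $A(x_i)$ for the set of controls at $x_i$, $C(x_i,a)$ for the cost, and $p_{ij}(a)$ for the probability of moving from $x_i$ to $x_j$ (with $x_{M+1}=t$). A control mapping $\mu$ assigns to each state an available control; a policy is a sequence $\pi=(\mu_0,\mu_1,\dots)$ of control mappings; it is stationary, denoted by $\mu$, if all $\mu_k=\mu$. The cost of $\pi$ from $x$ is the expected total cost $\mathcal J(x,\pi)=E\big[\sum_{k\ge0}C(y_k,\mu_k(y_k))\big]$ with $y_0=x$, where $y_k$ is the state at stage $k$. The value function is $U(x)=\inf_\pi\mathcal J(x,\pi)$, $U(t)=0$, $U_i=U(x_i)$. A policy is optimal if it attains $U(x)$ for all $x\in X$. Let $X_c$ be the set of nodes from which some policy leads to $t$ with probability 1; $U=+\infty$ off $X_c$. The convention $0\cdot(+\infty)=0$ is used. Given $\delta\ge0$, an optimal stationary policy $\mu^*$ is consistently $\delta$-improving if, for $x_i\in X_c\setminus\{t\}$, $p_{ij}(\mu^*(x_i))>0$ implies $U_i>U_j+\delta$. The MSSP is absolutely $\delta$-causal if every optimal stationary policy is consistently $\delta$-improving; it is absolutely causal if this holds with $\delta=0$. Absolute causality of a mode. For $m\in\mathcal M(x)$ with $n=|m|$, put $C(\xi)=C^m(x,\xi)$. For $W\in\mathbb R^n_{+,0}$ let $V(W)=\min_{\xi\in\Xi_n}\{C(\xi)+\xi^TW\}$ and let $\Xi^*(W)$ be the set of minimizers. The mode is absolutely $\delta$-causal ($\delta\ge 0$) if for all $W\in\mathbb R^n_{+,0}$, all $\xi^*\in\Xi^*(W)$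 and all $j$: $\xi^*_j>0$ implies $V(W)>W_j+\delta$. It is absolutely causal if this holds with $\delta=0$. Dijkstra-like method. Nodes are split into permanently labeled nodes $P$ (initially empty) and tentatively labeled nodes $L$ (initially $X$); the initial labels are $0$ at $t$ and $+\infty$ elsewhere. At each stage, a node $\bar x\in L$ with the smallest tentative label is moved from $L$ to $P$. Then for each $x_i\in L$ the label is replaced by the minimum of its current value and $\inf\{C(x_i,a)+\sum_j p_{ij}(a)U_j\}$ over all $a\in A(x_i)$ that have positive transition probability to $\bar x$ and zero transition probability to every node not in $P$ (here the $U_j$ are the labels of nodes in $P$). The method stops when $L$ is empty or all remaining labels are $+\infty$. Dial-like method with buckets of width $\Delta>0$. The initialization is the same; nodes with finite tentative labels are kept in buckets $[k\Delta,(k+1)\Delta)$, $k=0,1,2,\dots$. At each stage, all nodes in the first nonempty bucket are simultaneously moved from $L$ to $P$. Then the labels of nodes $x_i\in L$ are recomputed as the minimum of the current label and $\inf\{C(x_i,a)+\sum_jp_{ij}(a)U_j\}$ over controls $a\in A(x_i)$ with zero transition probability to every node not in $P$; these nodes are re-bucketed, and the method continues with the next bucket until $L$ is empty or all remaining labels are $+\infty$. A method is applicable if upon termination every label equals the value function $U$. *)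

(* Defs.v *)
From HB Require Import structures.
From mathcomp Require Import all_boot all_order all_algebra.
From mathcomp Require Import all_classical all_reals all_analysis.

Set Implicit Arguments.
Unset Strict Implicit.
Unset Printing Implicit Defensive.

Import Order.TTheory GRing.Theory Num.Theory.
Import numFieldNormedType.Exports.

Local Open Scope classical_set_scope.
Local Open Scope ring_scope.

Definition simplex (R : realType) (n : nat) : set 'rV[R]_n :=
  [set xi | (forall j, 0 <= xi 0 j) /\ \sum_j xi 0 j = 1].
Arguments simplex : clear implicits.

(* [Some i] is the node x_i and [None] is the target t.  Modes are indexed by
   position in the list of modes of x_i, so that two modes with the same
   successors may have different costs. *)
Record mssp (R : realType) := MSSP {
  nnodes : nat;
  nmodes : 'I_nnodes -> nat;
  mode : forall i, 'I_(nmodes i) -> seq (option 'I_nnodes);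
  cost : forall i (m : 'I_(nmodes i)), 'rV[R]_(size (mode m)) -> R;
  kappa : nat;
  nmodes_gt0 : forall i, (0 < nmodes i)%N;
  mode_size_gt0 : forall i (m : 'I_(nmodes i)), (0 < size (mode m))%N;
  mode_uniq : forall i (m : 'I_(nmodes i)), uniq (mode m);
  mode_irrefl : forall i (m : 'I_(nmodes i)), Some i \notin mode m;
  cost_gt0 : forall i (m : 'I_(nmodes i)) xi,
    simplex R (size (mode m)) xi -> 0 < cost xi;
  cost_continuous : forall i (m : 'I_(nmodes i)),
    {within simplex R (size (mode m)), continuous (@cost i m)};
  kappaP : forall i, (\sum_(m < nmodes i) size (mode m) <= kappa)%N }.

Section Mssp.
Variables (R : realType) (S : mssp R).

Definition state := option 'I_(nnodes S).
Definition target : state := None.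

Record control (i : 'I_(nnodes S)) := Control {
  ctl_mode : 'I_(nmodes i);
  ctl_prob : 'rV[R]_(size (mode ctl_mode));
  ctl_probP : simplex R (size (mode ctl_mode)) ctl_prob }.

Definition ctl_cost i (a : control i) : R := cost (ctl_prob a).

Definition trans i (a : control i) (y : state) : R :=
  \sum_(k < size (mode (ctl_mode a)) | nth target (mode (ctl_mode a)) k == y)
    ctl_prob a 0 k.

(* No control is needed at the target, which is absorbing and cost-free. *)
Definition control_map := forall i, control i.
Definition policy := nat -> control_map.
Definition stationary (mu : control_map) : policy := fun=> mu.

Definition stage_cost (mu : control_map) (x : state) : R :=
  if x is Some i then ctl_cost (mu i) else 0.

Definition step_prob (mu : control_map) (x y : state) : R :=
  if x is Some i then trans (mu i) y else (y == target)%:R.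

Section ModeCausality.
Variables (i : 'I_(nnodes S)) (m : 'I_(nmodes i)).
Let n := size (mode m).

Definition mode_objective (W xi : 'rV[R]_n) : R :=
  cost xi + \sum_j xi 0 j * W 0 j.

(* The infimum is attained: the objective is continuous on a compact set. *)
Definition mode_value (W : 'rV[R]_n) : R :=
  inf [set mode_objective W xi | xi in simplex R n].

Definition mode_minimizers (W : 'rV[R]_n) : set 'rV[R]_n :=
  [set xi | simplex R n xi /\
    forall xi', simplex R n xi' -> mode_objective W xi <= mode_objective W xi'].

Definition mode_absolutely_delta_causal (delta : R) : Prop :=
  forall W : 'rV[R]_n, (forall j, 0 <= W 0 j) ->
  forall xi, mode_minimizers W xi ->
  forall j, 0 < xi 0 j -> W 0 j + delta < mode_value W.

Definition mode_absolutely_causal : Prop := mode_absolutely_delta_causal 0.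

End ModeCausality.

(* [Y k] is the state at stage k when following [pi] from [x]: its joint laws
   are those of the controlled Markov chain started at [x]. *)
Definition controlled_process (d : measure_display) (Omega : measurableType d)
    (P : probability Omega R) (pi : policy) (x : state)
    (Y : nat -> Omega -> state) : Prop :=
  (forall k y, measurable [set w | Y k w = y]) /\
  (forall (n : nat) (s : nat -> state),
    P [set w | forall k, (k <= n)%N -> Y k w = s k] =
    ((s 0%N == x)%:R * \prod_(k < n) step_prob (pi k) (s k) (s k.+1))%:E).

Section Process.
Variables (d : measure_display) (Omega : measurableType d).
Variables (P : probability Omega R).
Variable Y : policy -> state -> nat -> Omega -> state.

Definition total_cost (x : state) (pi : policy) : \bar R :=
  (\int[P]_w \sum_(0 <= k <oo) (stage_cost (pi k) (Y pi x k w))%:E)%E.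

Definition value (x : state) : \bar R := ereal_inf (range (total_cost x)).

Definition optimal (pi : policy) : Prop :=
  forall x, total_cost x pi = value x.

Definition Xc : set state :=
  [set x | exists pi, P [set w | exists k, Y pi x k w = target] = 1%E].

Definition consistently_improving (delta : R) (mu : control_map) : Prop :=
  forall i, Xc (Some i) -> forall y, 0 < trans (mu i) y ->
  (value y + delta%:E < value (Some i))%E.

Definition absolutely_delta_causal (delta : R) : Prop :=
  forall mu, optimal (stationary mu) -> consistently_improving delta mu.

Definition absolutely_causal : Prop := absolutely_delta_causal 0.

Record config := Config {
  permanent : {set state};
  label : state -> \bar R }.

Definition init_config : config :=
  Config finset.set0 (fun y => if y == target then 0%E else +oo%E).

Definition stopped (c : config) : Prop :=
  forall y, y \notin permanent c -> label c y = +oo%E.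

Definition backup (lab : state -> \bar R) i (a : control i) : \bar R :=
  ((ctl_cost a)%:E + \sum_(y : state) (trans a y)%:E * lab y)%E.

Definition feasible (Q : {set state}) i : set (control i) :=
  [set a | forall y, y \notin Q -> trans a y = 0].

Definition relabel (Q : {set state}) (A : forall i, set (control i))
    (lab : state -> \bar R) (y : state) : \bar R :=
  if y is Some i then
    if Some i \in Q then lab (Some i)
    else Order.min (lab (Some i)) (ereal_inf [set backup lab a | a in A i])
  else lab target.

(* A relation rather than a function, because ties are broken arbitrarily. *)
Definition dijkstra_step (c c' : config) : Prop :=
  exists x : state,
    [/\ x \notin permanent c,
        (label c x < +oo)%E,
        forall y, y \notin permanent c -> (label c x <= label c y)%E,
        permanent c' = x |: permanent c &
        forall y, label c' y =
          relabel (permanent c')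
            (fun i => [set a | 0 < trans a x] `&` feasible (permanent c') (i:=i))
            (label c) y].

Definition in_bucket (Delta : R) (k : nat) (l : \bar R) : bool :=
  ((k%:R * Delta)%:E <= l < (k.+1%:R * Delta)%:E)%E.

Definition dial_step (Delta : R) (c c' : config) : Prop :=
  exists k : nat,
    [/\ exists2 y, y \notin permanent c & in_bucket Delta k (label c y),
        forall k' y, (k' < k)%N -> y \notin permanent c ->
          ~~ in_bucket Delta k' (label c y),
        permanent c' = permanent c :|:
          [set y in ~: permanent c | in_bucket Delta k (label c y)]%SET &
        forall y, label c' y =
          relabel (permanent c') (fun i => feasible (permanent c') (i:=i))
            (label c) y].

(* Every run of the method (repeating its last configuration once stopped)
   terminates, with all labels equal to the value function. *)
Definition applicable (step : config -> config -> Prop) : Prop :=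
  forall run : nat -> config,
    run 0%N = init_config ->
    (forall n, step (run n) (run n.+1) \/
               stopped (run n) /\ run n.+1 = run n) ->
    exists2 n, stopped (run n) & forall y, label (run n) y = value y.

Definition dijkstra_applicable : Prop := applicable dijkstra_step.
Definition dial_applicable (Delta : R) : Prop := applicable (dial_step Delta).

End Process.

Definition is_min_over_modes (delta : forall i, 'I_(@nmodes R S i) -> R)
    (Delta : R) : Prop :=
  (exists i (m : 'I_(nmodes i)), delta i m = Delta) /\
  (forall i (m : 'I_(nmodes i)), Delta <= delta i m).

End Mssp.

(* Main.v *)
Require Import Defs.
From HB Require Import structures.
From mathcomp Require Import all_boot all_order all_algebra.
From mathcomp Require Import all_classical all_reals all_analysis.
From mathcomp Require Import measurable_realfun.

Set Implicit Arguments.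
Unset Strict Implicit.
Unset Printing Implicit Defensive.

Import Order.TTheory GRing.Theory Num.Theory.
Import numFieldNormedType.Exports.

Local Open Scope classical_set_scope.
Local Open Scope ring_scope.

(** Perron's method yields a solution [V] of the Bellman equation which is real
    on the nodes connected to the target.  At a connected node a control
    attaining the equation minimizes the objective of its mode with weights
    [V], where the nodes disconnected from the target get a large finite
    weight; causality of the mode then says that such a control only leads to
    nodes of smaller [V].  Summing the Bellman inequalities along the process
    identifies [V] with the value function and shows that optimal stationary
    policies only use attaining controls, which gives causality of the problem.
    In both label-setting methods, a tentative node of least value has an
    optimal control supported on permanent nodes, so its label is exact; this
    forces the labels made permanent at each stage to be exact. *)

(** * Controls and modes *)

Lemma compact_simplex (R : realType) (n : nat) : compact (simplex R n).
Proof.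
have cube : compact [set v : 'rV[R]_n | forall i, `[0, 1]%classic (v ord0 i)].
  by apply: (@rV_compact R n (fun=> `[0, 1]%classic)) => _; exact: segment_compact.
apply: subclosed_compact cube _; last first.
  move=> v [v0 v1] i /=; rewrite in_itv /= v0 /= -v1 (bigD1 i) //= lerDl.
  by apply: sumr_ge0 => j _; exact: v0.
have -> : simplex R n = (\bigcap_j [set v : 'rV[R]_n | 0 <= v 0 j]) `&`
    [set v : 'rV[R]_n | \sum_j v 0 j = 1].
  apply/seteqP; split=> v [v0 v1]; split=> // j.
    by move=> _; exact: v0.
  exact: v0.
apply: closedI.
  apply: closed_bigI => j _.
  apply: (@preimage_closed _ _ (fun v : 'rV[R]_n => v 0 j) [set y | 0 <= y]).
    by move=> v _; exact: coord_continuous.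
  exact: closed_ge.
apply: (@preimage_closed _ _ (fun v : 'rV[R]_n => \sum_j v 0 j) [set 1]).
  move=> v _; apply: continuous_big => [|j _]; first exact: add_continuous.
  exact: coord_continuous.
exact: closed_eq.
Qed.

Lemma simplex_delta (R : realType) (n : nat) (k : 'I_n) :
  simplex R n (delta_mx 0 k).
Proof.
split=> [j|]; first by rewrite mxE ler0n.
rewrite (bigD1 k) //= big1 ?addr0 => [|j /negbTE jk]; rewrite mxE ?eqxx //=.
by rewrite jk.
Qed.

Section Controls.
Variables (R : realType) (S : mssp R) (i : 'I_(nnodes S)).
Implicit Types (a : control i) (m : 'I_(nmodes i)) (w : state S -> R).

Definition vertex_control m (k : 'I_(size (mode m))) : control i :=
  @Control R S i m _ (simplex_delta R k).

Lemma ctl_cost_gt0 a : 0 < ctl_cost a.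
Proof. exact/cost_gt0/ctl_probP. Qed.

Lemma trans_ge0 a y : 0 <= trans a y.
Proof. by apply: sumr_ge0 => k _; exact: (ctl_probP a).1. Qed.

(** Transitions are indexed by states, mode objectives by positions in the mode; grouping the
    positions by the state they hold passes from one to the other. *)
Lemma sum_trans a w : \sum_y trans a y * w y =
  \sum_k ctl_prob a 0 k * w (nth (target S) (mode (ctl_mode a)) k).
Proof.
rewrite [RHS](partition_big
  (fun k : 'I_(size (mode (ctl_mode a))) =>
     nth (target S) (mode (ctl_mode a)) k) xpredT) //=.
apply: eq_bigr => y _; rewrite /trans big_distrl /=.
by apply: eq_bigr => k /eqP ->.
Qed.

Lemma sum_trans1 a : \sum_y trans a y = 1.
Proof.
rewrite -[RHS](ctl_probP a).2.
transitivity (\sum_y trans a y * 1); first by apply: eq_bigr => y _; rewrite mulr1.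
by rewrite sum_trans; apply: eq_bigr => k _; rewrite mulr1.
Qed.

Lemma trans_gt0 a y : 0 < trans a y -> exists2 k,
  0 < ctl_prob a 0 k & nth (target S) (mode (ctl_mode a)) k = y.
Proof.
move=> py; apply: contrapT => none; move: py.
rewrite /trans big1 ?ltxx // => k /eqP ky; apply/eqP.
rewrite eq_le (ctl_probP a).1 andbT leNgt; apply/negP => k0.
by apply: none; exists k.
Qed.

Lemma trans_mode a y : 0 < trans a y -> y \in mode (ctl_mode a).
Proof. by move=> /trans_gt0[k _ <-]; exact: mem_nth. Qed.

Definition lookahead w a : R := ctl_cost a + \sum_y trans a y * w y.

Definition mode_successors w m : 'rV[R]_(size (mode m)) :=
  \row_k w (nth (target S) (mode m) k).

Lemma lookahead_objective w a : lookahead w a =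
  mode_objective (mode_successors w (ctl_mode a)) (ctl_prob a).
Proof.
rewrite /lookahead sum_trans /mode_objective.
by congr (_ + _); apply: eq_bigr => k _; rewrite mxE.
Qed.

Lemma lookahead_vertex w m (k : 'I_(size (mode m))) :
  lookahead w (vertex_control k) =
  ctl_cost (vertex_control k) + w (nth (target S) (mode m) k).
Proof.
rewrite /lookahead sum_trans /= (bigD1 k) //= mxE !eqxx mul1r big1 ?addr0 //.
by move=> j /negbTE jk; rewrite mxE jk andbF mul0r.
Qed.

Lemma le_lookahead w w' a : (forall y, w y <= w' y) ->
  lookahead w a <= lookahead w' a.
Proof.
move=> ww'; rewrite lerD2l; apply: ler_sum => y _.
by rewrite ler_wpM2l ?trans_ge0.
Qed.

Lemma mode_minimizers_neq0 m (W : 'rV[R]_(size (mode m))) :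
  mode_minimizers W !=set0.
Proof.
have k0 : 'I_(size (mode m)) := Ordinal (mode_size_gt0 m).
have [||c /set_mem cS cmin] :=
    @compact_EVT_min _ R (mode_objective W) _ _ (@compact_simplex R (size (mode m))).
- by exists (delta_mx 0 k0); exact: simplex_delta.
- apply: (@within_continuousD _ _ _ _ (@cost _ _ i m)
    (fun xi : 'rV[R]_(size (mode m)) => \sum_j xi 0 j * W 0 j)).
    exact: cost_continuous.
  apply: continuous_subspaceT; apply: continuous_big => [|j _ v].
    exact: add_continuous.
  by apply: continuousM; [exact: coord_continuous|exact: cst_continuous].
- by exists c; split => // xi' /mem_set; exact: cmin.
Qed.

Lemma mode_value_minimizer m (W xi : 'rV[R]_(size (mode m))) :
  mode_minimizers W xi -> mode_value W = mode_objective W xi.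
Proof.
move=> [xiS ximin]; apply/eqP; rewrite eq_le; apply/andP; split.
  apply: ge_inf; last by exists xi.
  by exists (mode_objective W xi) => _ [xi' xi'S <-]; exact: ximin.
apply: lb_le_inf; first by exists (mode_objective W xi), xi.
by move=> _ [xi' xi'S <-]; exact: ximin.
Qed.

(** A minimum exists inside each mode by compactness of the simplex, and a node has finitely many
    modes. *)
Lemma lookahead_minimum w : exists a, forall a', lookahead w a <= lookahead w a'.
Proof.
have best m : {a : control i | ctl_mode a = m &
    forall a', ctl_mode a' = m -> lookahead w a <= lookahead w a'}.
  have /cid[xi [xiS ximin]] := @mode_minimizers_neq0 m (mode_successors w m).
  exists (Control xiS) => // -[m' xi' xi'S] /= mm'; move: xi' xi'S.
  by rewrite mm' => xi' xi'S; rewrite !lookahead_objective; exact: ximin.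
pose f m := lookahead w (s2val (best m)).
have m0 : 'I_(nmodes i) := Ordinal (nmodes_gt0 i).
have [m _ mmin] := Order.TotalTheory.arg_minP (i0 := m0) f (P := xpredT) erefl.
exists (s2val (best m)) => a.
have /= le1 := mmin (ctl_mode a) erefl.
by apply: le_trans le1 _; exact: (s2valP' (best (ctl_mode a))).
Qed.

Lemma ctl_cost_lower_bound : exists2 c, 0 < c & forall a, c <= ctl_cost a.
Proof.
have [a amin] := lookahead_minimum (fun=> 0).
exists (ctl_cost a) => [|a']; first exact: ctl_cost_gt0.
have := amin a'; rewrite /lookahead.
by do 2!(rewrite big1 => [|? _]; rewrite ?mulr0 //); rewrite !addr0.
Qed.

End Controls.

(** * The Bellman equation *)

Section Bellman.
Variables (R : realType) (S : mssp R).
Implicit Types (i : 'I_(nnodes S)) (x y : state S) (w : state S -> R).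

Definition subsolution w : Prop :=
  [/\ w (target S) = 0, forall y, 0 <= w y &
      forall i (a : control i), w (Some i) <= lookahead w a].

(** The vertices of the simplex are controls, so each of these edges can be followed with certainty;
    connection to the target becomes a matter of graph paths. *)
Definition successor : rel (state S) := fun x y =>
  if x is Some i then [exists m : 'I_(nmodes i), y \in mode m] else false.

Definition reaching x : bool := connect successor x (target S).

Lemma trans_successor i (a : control i) y :
  0 < trans a y -> successor (Some i) y.
Proof. by move=> /trans_mode ya; apply/existsP; exists (ctl_mode a). Qed.

Lemma reachingP x : reflect
  (x = target S \/ exists2 y, successor x y & reaching y) (reaching x).
Proof.
rewrite /reaching; apply: (iffP idP) => [/fingraph.connectP[[|y p] /=]|[->|[y xy yt]]].
- by move=> _ <-; left.
- by move=> /andP[xy yp] eqt; right; exists y => //; apply/fingraph.connectP; exists p.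
- exact: connect0.
- exact: connect_trans (connect1 xy) yt.
Qed.

Lemma trans_reaching i (a : control i) y :
  0 < trans a y -> reaching y -> reaching (Some i).
Proof.
by move=> py yt; apply/reachingP; right; exists y => //; exact: trans_successor py.
Qed.

(** Along a path to the target followed by vertex controls, a subsolution is at most the sum of
    their costs, a bound that depends on the path alone. *)
Lemma subsolution_bounded : exists2 B, 0 <= B &
  forall w, subsolution w -> forall x, reaching x -> w x <= B.
Proof.
have bound x : {b | 0 <= b & forall w, subsolution w -> reaching x -> w x <= b}.
  apply: cid2; have [|xt] := boolP (reaching x); last by exists 0.
  rewrite /reaching => /fingraph.connectP[p]; elim: p x => [|y p IH] x /=.
    by move=> _ <-; exists 0 => // w [-> _ _].
  move=> /andP[xy yp] /IH-/(_ yp)[b b0 hb].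
  case: x xy => [i|//] /= /existsP[m ym].
  have ksz : (index y (mode m) < size (mode m))%N by rewrite index_mem.
  pose a := vertex_control (Ordinal ksz).
  exists (ctl_cost a + b) => [|w wS _].
    by rewrite addr_ge0 // ltW // ctl_cost_gt0.
  have [_ _ /(_ _ a) le1] := wS; apply: le_trans le1 _.
  rewrite lookahead_vertex /= nth_index // lerD2l; exact: hb.
exists (\sum_x s2val (bound x)).
  by apply: sumr_ge0 => x _; exact: (s2valP (bound _)).
move=> w wS x xt; apply: le_trans (s2valP' (bound x) w wS xt) _.
by rewrite (bigD1 x) //= lerDl sumr_ge0 // => y _; exact: (s2valP (bound _)).
Qed.

(** A control at a disconnected node leads only to disconnected nodes, so its lookahead is its cost
    plus [N]. Letting [N] grow yields the infinite values off the connected nodes. *)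
Lemma subsolution_nonreaching (N : R) : 0 <= N ->
  subsolution (fun x => if reaching x then 0 else N).
Proof.
move=> N0; split=> [|y|i a]; first by rewrite /reaching connect0.
  by case: ifP.
have c0 := ctl_cost_gt0 a.
have [it|it] := boolP (reaching (Some i)).
  apply: addr_ge0; first exact: ltW.
  by apply: sumr_ge0 => y _; rewrite mulr_ge0 ?trans_ge0 //; case: ifP.
rewrite /lookahead (eq_bigr (fun y => trans a y * N)) => [|y _].
  by rewrite -mulr_suml sum_trans1 mul1r lerDr ltW.
case: ifPn => // yt; suff -> : trans a y = 0 by rewrite !mul0r.
apply/eqP; rewrite eq_le trans_ge0 andbT leNgt; apply/negP => py.
by move: it; rewrite (trans_reaching py yt).
Qed.

(* Perron's method: the pointwise supremum [V] of the subsolutions bounded by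
   [N] is one of them, and where [V < N] it meets the Bellman equation, since
   otherwise it could be increased at that node. *)
Lemma bellman_solution : exists N, exists V : state S -> R,
  [/\ subsolution V, forall x, reaching x -> V x < N,
      forall x, ~~ reaching x -> V x = N &
      forall i, reaching (Some i) ->
        exists a : control i, lookahead V a = V (Some i)].
Proof.
have [B B0 hB] := subsolution_bounded.
(* [N] exceeds [B], so the cap is not reached at connected nodes and leaves room there for an
   increase by 1. *)
pose N := B + 1; have N0 : 0 <= N by rewrite addr_ge0.
pose sol w := subsolution w /\ forall x, w x <= N.
pose V x := sup [set w x | w in sol].
have sol0 := subsolution_nonreaching N0.
have sol0N : sol (fun x => if reaching x then 0 else N).
  by split=> // x; case: ifP.
have nonempty x : [set w x | w in sol] !=set0.
  exists (if reaching x then 0 else N).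
  by exists (fun x => if reaching x then 0 else N).
have le_V w x : sol w -> w x <= V x.
  move=> wsol; apply: ub_le_sup; last by exists w.
  by exists N => _ [w' [_ w'N] <-]; exact: w'N.
have V_le x b : (forall w, sol w -> w x <= b) -> V x <= b.
  by move=> hb; apply: ge_sup => // _ [w wsol <-]; exact: hb.
have VS : subsolution V.
  split=> [|y|i a].
  - apply/eqP; rewrite eq_le V_le => [|w [[-> _ _] _] //].
    by have := le_V _ (target S) sol0N; rewrite /reaching connect0.
  - by apply: le_trans (le_V _ y sol0N); case: ifP.
  - apply: V_le => w wsol; have [[_ _ /(_ _ a) le1] _] := wsol.
    by apply: le_trans le1 _; apply: le_lookahead => y; exact: le_V.
have VB x : reaching x -> V x <= B.
  by move=> xt; apply: V_le => w [wS _]; exact: hB.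
exists N, V; split=> // [x xt|x xt|i it].
- by rewrite (le_lt_trans (VB _ xt)) // ltrDl.
- apply/eqP; rewrite eq_le V_le => [|w [_ ->]//] /=.
  by apply: le_trans (le_V _ x sol0N); rewrite (negbTE xt).
have [a amin] := lookahead_minimum i V; exists a.
have [V0 Vge0 Vle] := VS.
apply/eqP; rewrite eq_le Vle andbT leNgt; apply/negP => lt_a.
(* The term 1 keeps the raised function at most [N]; the gap keeps the Bellman inequality at the
   raised node. Elsewhere the lookaheads can only grow. *)
pose eps := Num.min 1 (lookahead V a - V (Some i)).
have eps0 : 0 < eps by rewrite lt_min ltr01 subr_gt0.
pose w x := if x == Some i then V x + eps else V x.
have Vw x : V x <= w x by rewrite /w; case: ifP => // _; rewrite lerDl ltW.
suff : w (Some i) <= V (Some i) by rewrite /w eqxx gerDl leNgt eps0.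
apply: le_V; split=> [|x].
  split=> [|y|j b]; first by rewrite /w.
    exact: le_trans (Vw y).
  apply: le_trans (le_lookahead b Vw); rewrite /w; case: eqP => [[ij]|_] //.
  move: b; rewrite ij => b; apply: le_trans (amin b).
  by rewrite -lerBrDl ge_min lexx orbT.
rewrite /w; case: eqP => [->|_].
  by rewrite lerD ?VB // ge_min lexx.
by apply: V_le => w' [_ ->].
Qed.

(** A control that is best among all controls of the node is best in its own mode, so its lookahead
    is the mode value; a state of positive probability sits at a position of positive weight. *)
Lemma causal_minimizer (delta : R) w i (a : control i) y :
  mode_absolutely_delta_causal (ctl_mode a) delta -> (forall y, 0 <= w y) ->
  (forall a' : control i, lookahead w a <= lookahead w a') ->
  0 < trans a y -> w y + delta < lookahead w a.
Proof.
move=> causal w0 amin /trans_gt0[k k0 <-].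
have amin' : mode_minimizers (mode_successors w (ctl_mode a)) (ctl_prob a).
  split=> [|xi xiS]; first exact: ctl_probP.
  by have := amin (Control xiS); rewrite !lookahead_objective.
have := causal _ _ _ amin' _ k0; rewrite (mode_value_minimizer amin').
by rewrite -lookahead_objective mxE; apply=> j; rewrite mxE.
Qed.

End Bellman.

(** * Label-setting methods *)

Section LabelSetting.
Variables (R : realType) (S : mssp R) (U : state S -> \bar R) (Delta : R).
Hypothesis Delta_ge0 : 0 <= Delta.
Hypothesis U_target : U (target S) = 0%E.
Hypothesis U_ge0 : forall y, (0 <= U y)%E.
Hypothesis U_le_backup : forall i (a : control i), (U (Some i) <= backup U a)%E.
Hypothesis U_causal : forall i, (U (Some i) < +oo)%E -> exists2 a : control i,
  backup U a = U (Some i) &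
  forall y, 0 < trans a y -> (U y + Delta%:E < U (Some i))%E.
Implicit Types (c : config S) (Q : {set state S}).

(** Invariant of both methods. By the last clause every control supported on permanent nodes is
    already accounted for, so a label is exact as soon as some optimal control is supported
    there. *)
Definition sound c : Prop :=
  [/\ label c (target S) = 0%E,
      forall y, y \in permanent c -> label c y = U y,
      forall y, (U y <= label c y)%E &
      forall i (a : control i), Some i \notin permanent c ->
        feasible (permanent c) a -> (label c (Some i) <= backup U a)%E].

Lemma sound_init : sound (init_config S).
Proof.
split=> [|y|y|i a _ afeas]; rewrite /= ?eqxx ?inE //.
  by case: eqP => [->|_]; rewrite ?U_target // leey.
(* Probabilities sum to one, so no control is feasible for the empty set. *)
have := sum_trans1 a; rewrite big1 => [/esym/eqP|y _]; first by rewrite oner_eq0.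
by apply: afeas; rewrite inE.
Qed.

Lemma backup_feasible Q lab i (a : control i) : feasible Q a ->
  (forall y, y \in Q -> lab y = U y) -> backup lab a = backup U a.
Proof.
move=> afeas labU; congr (_ + _)%E; apply: eq_bigr => y _.
by have [/labU ->//|/afeas ->] := boolP (y \in Q); rewrite !mul0e.
Qed.

(** Update shared by both methods, with [A] the controls scanned. A control that was feasible before
    the step may be skipped, because the label already accounts for it. *)
Lemma sound_relabel c c' Q (A : forall i, set (control i)) :
  sound c -> permanent c \subset Q ->
  (forall y, y \in Q -> label c y = U y) ->
  (forall i (a : control i), A i a -> feasible Q a) ->
  (forall i (a : control i), feasible Q a -> A i a \/ feasible (permanent c) a) ->
  permanent c' = Q -> (forall y, label c' y = relabel Q A (label c) y) ->
  sound c'.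
Proof.
move=> [label_t labelP U_label label_le] PQ labelQ AQ QA permQ labelE.
have AU i a : A i a -> backup (label c) a = backup U a.
  by move=> /AQ afeas; exact: backup_feasible afeas labelQ.
split=> [|y|y|i a]; rewrite ?permQ ?labelE //.
- by move=> yQ; rewrite -labelQ //; case: y yQ => [i|//] /= ->.
- case: y => [i|] /=; last exact: U_label.
  case: ifP => // iQ; rewrite le_min U_label /=.
  by apply: le_ereal_inf_tmp => _ [a /AU -> <-]; exact: U_le_backup.
- move=> iQ /[dup] afeas /QA[Aa|aP]; rewrite /= (negbTE iQ) ge_min.
    apply/orP; right; apply: ereal_inf_lbound; exists a => //.
    exact: AU.
  apply/orP; left; apply: label_le => //; apply: contra iQ; exact/fintype.subsetP.
Qed.

(* A minimizer of [U] among the tentative nodes has an optimal control that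
   only uses permanent nodes, so that its label is correct. *)
Lemma exact_tentative c y : sound c -> y \notin permanent c -> (U y < +oo)%E ->
  exists y', [/\ y' \notin permanent c, (U y' <= U y)%E & label c y' = U y'].
Proof.
move=> [label_t _ U_label label_le] yP Uy.
have [y' y'P y'min] := Order.TotalTheory.arg_minP
  (P := fun z => z \notin permanent c) (i0 := y) U yP.
exists y'; split=> //; first exact: y'min.
case: y' y'P y'min => [i|] iP imin; last by rewrite -[None]/(target S) label_t U_target.
have [|a aE acausal] := @U_causal i; first exact: le_lt_trans (imin _ yP) Uy.
apply/eqP; rewrite eq_le U_label andbT -aE label_le // => z zP.
apply/eqP; rewrite eq_le trans_ge0 andbT leNgt; apply/negP => /acausal.
apply/negP; rewrite -leNgt; apply: le_trans (imin _ zP) _.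
by rewrite leeDl // lee_fin.
Qed.

(** Otherwise a tentative node of finite value would provide one of finite label. *)
Lemma stopped_exact c : sound c -> stopped c -> forall y, label c y = U y.
Proof.
move=> cs cstop y; have [_ labelP U_label _] := cs.
have [/labelP//|yP] := boolP (y \in permanent c).
rewrite cstop //; apply/esym/eqP; rewrite eq_le leey leNgt; apply/negP => Uy.
have [y' [y'P /le_lt_trans/(_ Uy) y'fin y'lab]] := exact_tentative cs yP Uy.
by move: y'fin; rewrite -y'lab cstop.
Qed.

(** [exact_tentative] gives a tentative node whose exact label is at most the value of the chosen
    [x]; as [x] has the least label, its own label is exact. *)
Lemma dijkstra_sound c c' : sound c -> dijkstra_step c c' ->
  sound c' /\ (#|permanent c| < #|permanent c'|)%N.
Proof.
move=> cs [x [xP xfin xmin permE labelE]].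
split; last by rewrite permE cardsU1 xP.
have [_ labelP U_label _] := cs.
have x_exact : label c x = U x.
  have [y [yP Uyx ylab]] := exact_tentative cs xP (le_lt_trans (U_label x) xfin).
  apply/eqP; rewrite eq_le U_label andbT.
  by apply: le_trans (xmin _ yP) _; rewrite ylab.
apply: (sound_relabel cs _ _ _ _ erefl labelE) => [|y|i a []//|i a].
- by rewrite permE finset.subsetUr.
- by rewrite permE !inE => /orP[/eqP ->|/labelP].
(* A newly feasible control either moves to [x] and is scanned, or avoids [x] and was feasible
   already. *)
- move=> afeas; have [px|px] := ltP 0 (trans a x); [by left | right => y yP].
  have [->|yx] := eqVneq y x; first by apply/eqP; rewrite eq_le px trans_ge0.
  by apply: afeas; rewrite permE !inE negb_or yx.
Qed.

(** Tentative values are at least [k Delta], and values in bucket [k] are below [(k+1) Delta]. An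
    optimal control drops by more than [Delta], hence leads to permanent nodes, and the whole bucket
    is exact at once. *)
Lemma dial_sound c c' : 0 < Delta -> sound c -> dial_step Delta c c' ->
  sound c' /\ (#|permanent c| < #|permanent c'|)%N.
Proof.
move=> Delta0 cs [k [[y0 y0P y0k] kmin permE labelE]].
have [label_t labelP U_label label_le] := cs.
split; last first.
  apply: proper_card; rewrite permE; apply/properP; split; first exact: finset.subsetUl.
  by exists y0 => //; rewrite !inE y0P y0k orbT.
have tentative_ge y : y \notin permanent c -> ((k%:R * Delta)%:E <= U y)%E.
  move=> yP; rewrite leNgt; apply/negP => ylt.
  have [|y' [y'P /le_lt_trans/(_ ylt)]] := exact_tentative cs yP.
    exact: lt_trans ylt (ltry _).
  move: (U_ge0 y'); case: (U y') => [r||] //; rewrite lee_fin lte_fin => r0 rk labr.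
  (* The truncation of [r / Delta] is the index of the bucket of [r], which comes before [k]. *)
  have /truncn_itv/andP[ler ltr] : 0 <= r / Delta by rewrite divr_ge0.
  rewrite ler_pdivlMr // in ler; rewrite ltr_pdivrMr // in ltr.
  have k'k : (Num.truncn (r / Delta) < k)%N.
    by have := le_lt_trans ler rk; rewrite ltr_pM2r // ltr_nat.
  by have := kmin _ _ k'k y'P; rewrite /in_bucket labr lee_fin ler lte_fin ltr.
have bucket_exact y : y \notin permanent c -> in_bucket Delta k (label c y) ->
    label c y = U y.
  move=> yP /andP[_ ylt]; apply/eqP; rewrite eq_le U_label andbT.
  case: y yP ylt => [i|] iP ilt; last by rewrite -[None]/(target S) label_t U_target.
  have Ui := le_lt_trans (U_label _) ilt.
  have [|a aE acausal] := @U_causal i; first exact: lt_trans Ui (ltry _).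
  rewrite -aE label_le // => z zP.
  apply/eqP; rewrite eq_le trans_ge0 andbT leNgt; apply/negP => /acausal.
  move=> /lt_trans/(_ Ui); apply/negP; rewrite -leNgt -natr1 mulrDl mul1r EFinD.
  by rewrite leeD2r // tentative_ge.
apply: (sound_relabel cs _ _ _ _ erefl labelE) => [|y|i a //|i a]; last by left.
- by rewrite permE finset.subsetUl.
- by rewrite permE !inE => /orP[/labelP//|/andP[]]; exact: bucket_exact.
Qed.

Lemma sound_applicable (d : measure_display) (Omega : measurableType d)
    (P : probability Omega R) (Y : policy S -> state S -> nat -> Omega -> state S)
    (step : config S -> config S -> Prop) :
  (forall y, value P Y y = U y) ->
  (forall c c', sound c -> step c c' ->
    sound c' /\ (#|permanent c| < #|permanent c'|)%N) ->
  applicable P Y step.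
Proof.
move=> valueU step_sound run run0 runS.
have run_sound n : sound (run n).
  elim: n => [|n IH]; first by rewrite run0; exact: sound_init.
  by have [/(step_sound _ _ IH)[]|[_ ->]] := runS n.
have progress n : (exists m, stopped (run m)) \/ (n <= #|permanent (run n)|)%N.
  elim: n => [|n [|IH]]; [by right | by left |].
  have [/(step_sound _ _ (run_sound n))[_ lt_n]|[stop _]] := runS n.
    by right; exact: leq_ltn_trans lt_n.
  by left; exists n.
(* The permanent set cannot outgrow the state space, so the run must stop. *)
have [[n stop]|] := progress #|{: state S}|.+1.
  by exists n => // y; rewrite valueU; exact: stopped_exact.
by rewrite ltnNge max_card.
Qed.

End LabelSetting.

(** * The law of the controlled process *)

Lemma measure_fin_partition (d : measure_display) (Omega : measurableType d)
    (R : realType) (mu : {measure set Omega -> \bar R}) (T : finType)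
    (f : Omega -> T) (A : set Omega) : measurable A ->
  (forall y, measurable [set w | f w = y]) ->
  mu A = (\sum_y mu (A `&` [set w | f w = y]))%E.
Proof.
move=> mA mf; rewrite fsbig_seq ?index_enum_uniq //= -measure_fin_bigcup //.
- congr (mu _); apply/seteqP; split=> [w Aw|w [y _ []]//].
  by exists (f w) => //=; rewrite mem_index_enum.
- by move=> y y' _ _ [w [[_ <-] [_ <-]]].
- by move=> y _; exact: measurableI.
Qed.

Section Law.
Variables (R : realType) (S : mssp R) (pi : policy S) (x : state S).
Implicit Types (y : state S) (g : state S -> R).

(** Marginal laws by forward recursion; they turn integrals over [Omega] into finite sums. *)
Fixpoint law (n : nat) : state S -> R :=
  if n is n'.+1 then fun y => \sum_z law n' z * step_prob (pi n') z y
  else fun y => (y == x)%:R.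

Definition mean n g : R := \sum_y law n y * g y.

Lemma step_prob_ge0 (mu : control_map S) y z : 0 <= step_prob mu y z.
Proof. by case: y => [i|] /=; rewrite ?trans_ge0 ?ler0n. Qed.

Lemma stage_cost_ge0 (mu : control_map S) y : 0 <= stage_cost mu y.
Proof. by case: y => [i|] //=; rewrite ltW // ctl_cost_gt0. Qed.

Lemma law_ge0 n y : 0 <= law n y.
Proof.
elim: n y => [|n IH] y /=; first exact: ler0n.
by apply: sumr_ge0 => z _; rewrite mulr_ge0 ?step_prob_ge0.
Qed.

Lemma mean_ge0 n g : (forall y, 0 <= g y) -> 0 <= mean n g.
Proof. by move=> g0; apply: sumr_ge0 => y _; rewrite mulr_ge0 ?law_ge0. Qed.

Lemma le_mean n g g' : (forall y, law n y != 0 -> g y <= g' y) ->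
  mean n g <= mean n g'.
Proof.
move=> gg'; apply: ler_sum => y _; have [->|ny0] := eqVneq (law n y) 0.
  by rewrite !mul0r.
by rewrite ler_wpM2l ?law_ge0 ?gg'.
Qed.

Lemma mean0 g : mean 0 g = g x.
Proof.
rewrite /mean /= (bigD1 x) //= eqxx mul1r big1 ?addr0 // => y /negbTE ->.
by rewrite mul0r.
Qed.

Lemma meanS n g : mean n.+1 g =
  mean n (fun y => \sum_z step_prob (pi n) y z * g z).
Proof.
rewrite /mean /=; under eq_bigr do rewrite mulr_suml.
rewrite exchange_big; apply: eq_bigr => y _ /=; rewrite mulr_sumr.
by apply: eq_bigr => z _; rewrite mulrA.
Qed.

Lemma meanD n g g' : mean n (fun y => g y + g' y) = mean n g + mean n g'.
Proof. by rewrite -big_split; apply: eq_bigr => y _; rewrite mulrDr. Qed.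

Lemma meanZ n (c : R) g : mean n (fun y => c * g y) = c * mean n g.
Proof. by rewrite mulr_sumr; apply: eq_bigr => y _; rewrite mulrCA. Qed.

Section Probability.
Variables (d : measure_display) (Omega : measurableType d).
Variables (P : probability Omega R) (Y : nat -> Omega -> state S).
Hypothesis process_Y : controlled_process P pi x Y.

Lemma measurable_state k y : measurable [set w | Y k w = y].
Proof. by have [] := process_Y. Qed.

(** [controlled_process] gives the law of paths from stage 0; the induction sums out the earliest
    coordinate, and [j = n] leaves the marginal law. *)
Lemma joint_law j n (s : nat -> state S) : (j <= n)%N ->
  P [set w | forall k, (j <= k <= n)%N -> Y k w = s k] =
  (law j (s j) * \prod_(j <= k < n) step_prob (pi k) (s k) (s k.+1))%:E.
Proof.
elim: j s => [|j IH] s jn.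
  by rewrite big_mkord; exact: process_Y.2.
pose A := [set w | forall k, (j.+1 <= k <= n)%N -> Y k w = s k].
have mA : measurable A.
  rewrite (_ : A =
    \bigcap_(k in [set k | (j.+1 <= k <= n)%N]) [set w | Y k w = s k]) //.
  by apply: bigcap_measurableType => k _; exact: measurable_state.
rewrite -/A (measure_fin_partition P mA (measurable_state j)) /= mulr_suml.
rewrite -sumEFin; apply: eq_bigr => y _.
pose s' k := if k == j then y else s k.
transitivity (P [set w | forall k, (j <= k <= n)%N -> Y k w = s' k]).
  congr (P _); apply/seteqP; split=> w /=.
    move=> [Aw yw] k /andP[jk kn]; rewrite /s'; case: eqP => [->//|/eqP kj].
    by apply: Aw; rewrite kn ltn_neqAle eq_sym kj jk.
  move=> ws'; split=> [k /andP[jk kn]|].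
    by have := ws' k; rewrite /s' gtn_eqF // kn (ltnW jk); apply.
  by have := ws' j; rewrite /s' eqxx leqnn (ltnW jn); apply.
rewrite IH ?(ltnW jn) // (big_ltn jn) /s' eqxx gtn_eqF // mulrA; congr (_ * _)%:E.
by apply: eq_big_nat => k /andP[jk _]; rewrite !gtn_eqF // ltnW.
Qed.

Lemma state_law n y : P [set w | Y n w = y] = (law n y)%:E.
Proof.
have := joint_law (fun=> y) (leqnn n); rewrite big_geq // mulr1 => <-.
congr (P _); apply/seteqP; split=> w /= => [yw k|]; last first.
  by apply; rewrite leqnn.
by rewrite -eqn_leq => /eqP <-.
Qed.

Lemma state_fun_indic n g w : (g (Y n w))%:E =
  (\sum_y (g y)%:E * (\1_[set w' | Y n w' = y] w)%:E)%E.
Proof.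
rewrite (bigD1 (Y n w)) //= big1 => [|y /eqP yw].
  by rewrite indicE mem_set // mule1 adde0.
by rewrite indicE memNset ?mule0 // => /esym.
Qed.

Lemma measurable_indic_state n y :
  measurable_fun [set: Omega]
    (fun w => (\1_[set w' | Y n w' = y] w : R)%:E).
Proof. by apply/measurable_EFinP; exact/measurable_indic/measurable_state. Qed.

Lemma measurable_state_fun n g :
  measurable_fun [set: Omega] (fun w => (g (Y n w))%:E).
Proof.
under eq_fun do rewrite state_fun_indic.
by apply: emeasurable_sum => y; exact/measurable_funeM/measurable_indic_state.
Qed.

Lemma integral_state_fun n g : (forall y, 0 <= g y) ->
  (\int[P]_w (g (Y n w))%:E)%E = (mean n g)%:E.
Proof.
move=> g0; under eq_integral do rewrite state_fun_indic.
rewrite ge0_integral_sum //=; last 2 first.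
- by move=> y; exact/measurable_funeM/measurable_indic_state.
- by move=> y w _; rewrite -EFinM lee_fin mulr_ge0.
rewrite -sumEFin; apply: eq_bigr => y _.
rewrite ge0_integralZl_EFin //=; last exact: measurable_indic_state.
rewrite integral_indic //; last exact: measurable_state.
by rewrite setIT [X in (_ * X)%E](state_law n y) -EFinM mulrC.
Qed.

Lemma total_cost_mean : (\int[P]_w \sum_(0 <= k <oo) (stage_cost (pi k) (Y k w))%:E =
  \sum_(0 <= k <oo) (mean k (stage_cost (pi k)))%:E)%E.
Proof.
rewrite integral_nneseries //.
- by apply: eq_eseriesr => k _; apply: integral_state_fun => y; exact: stage_cost_ge0.
- by move=> k; exact: measurable_state_fun.
- by move=> k w _; rewrite lee_fin stage_cost_ge0.
Qed.

End Probability.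
End Law.

(** * Verification *)

Lemma le_lookahead_backup (R : realType) (S : mssp R) (U : state S -> \bar R)
    (w : state S -> R) i (a : control i) :
  (forall y, ((w y)%:E <= U y)%E) -> ((lookahead w a)%:E <= backup U a)%E.
Proof.
move=> wU; rewrite EFinD -sumEFin leeD2l //; apply: lee_sum => y _.
by rewrite EFinM lee_wpmul2l ?lee_fin ?trans_ge0.
Qed.

Section Verification.
Variables (R : realType) (S : mssp R).
Variables (d : measure_display) (Omega : measurableType d).
Variables (P : probability Omega R).
Variable Y : policy S -> state S -> nat -> Omega -> state S.
Hypothesis process_Y : forall (pi : policy S) (x : state S),
  controlled_process P pi x (Y pi x).
Implicit Types (w : state S -> R) (x y : state S) (pi : policy S).

Lemma subsolution_le_step w (mu : control_map S) y : subsolution w ->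
  w y <= stage_cost mu y + \sum_z step_prob mu y z * w z.
Proof.
move=> [w_t w0 w_le]; case: y => [i|]; first exact: w_le.
by rewrite -[None]/(target S) w_t add0r sumr_ge0 // => z _; rewrite mulr_ge0.
Qed.

(** Costs at each of the finitely many nodes have a positive lower bound, and both sides vanish at
    the target. Stage costs tending to 0 thus force the means of [w] to 0. *)
Lemma subsolution_le_stage_cost w : subsolution w ->
  exists2 K, 0 < K & forall (mu : control_map S) y, w y <= K * stage_cost mu y.
Proof.
move=> [w_t w0 _].
have bound (i : 'I_(nnodes S)) :
    {c | 0 < c & forall a : control i, c <= ctl_cost a}.
  exact/cid2/ctl_cost_lower_bound.
have ratio_ge0 i : 0 <= w (Some i) / s2val (bound i).
  by rewrite divr_ge0 // ltW //; exact: (s2valP (bound i)).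
(* The sum dominates the ratio at every node; the 1 makes the constant positive. *)
exists (1 + \sum_i w (Some i) / s2val (bound i)) => [|mu [i|]] /=.
- by rewrite ltr_pwDl // sumr_ge0.
- have c0 := s2valP (bound i).
  have -> : w (Some i) = w (Some i) / s2val (bound i) * s2val (bound i).
    by rewrite divfK // gt_eqF.
  apply: ler_pM => //; [exact: ltW | | exact: (s2valP' (bound i))].
  by rewrite (bigD1 i) //= addrCA lerDl addr_ge0 // sumr_ge0.
- by rewrite mulr0 -[None]/(target S) w_t.
Qed.

(* If the total cost is finite then the stage costs, hence also the means of
   [w], tend to [0], so that the telescoped Bellman inequalities give the
   bound.  Keeping the first stage aside makes it sharp enough to recognize
   the optimal controls. *)
Lemma total_cost_ge_lookahead w pi i : subsolution w ->
  ((lookahead w (pi 0%N i))%:E <= total_cost P Y (Some i) pi)%E.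
Proof.
move=> wS; rewrite /total_cost (total_cost_mean (process_Y _ _)).
pose c k := mean pi (Some i) k (stage_cost (pi k)).
pose e k := mean pi (Some i) k w.
have -> : lookahead w (pi 0%N i) = c 0%N + e 1%N by rewrite /c /e meanS !mean0.
have c0 k : 0 <= c k by apply: mean_ge0 => y; exact: stage_cost_ge0.
have [K K0 wK] := subsolution_le_stage_cost wS.
have eK k : e k <= K * c k by rewrite -meanZ; apply: le_mean => y _; exact: wK.
have e_step k : e k <= c k + e k.+1.
  rewrite /e meanS -meanD; apply: le_mean => y _; exact: subsolution_le_step.
have telescope n : c 0%N + e 1%N <= \sum_(0 <= k < n.+1) c k + e n.+1.
  elim: n => [|n IH]; first by rewrite big_nat1.
  by rewrite big_nat_recr //= -addrA (le_trans IH) // lerD2l.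
rewrite leNgt; apply/negP => lt_total.
have le_total n : ((\sum_(0 <= k < n) c k)%:E <= \sum_(0 <= k <oo) (c k)%:E)%E.
  by rewrite -sumEFin; apply: nneseries_lim_ge => k _ _; rewrite lee_fin.
move: lt_total le_total; set total := (\sum_(0 <= k <oo) (c k)%:E)%E.
have : (0 <= total)%E by apply: nneseries_ge0 => k _ _; rewrite lee_fin.
case: total => [r||] // r0; rewrite lte_fin => lt_r le_r; rewrite lee_fin in r0.
(* A total [r] below the bound leaves a mean of [w] of at least [g * K] at every stage from 1 on,
   hence stage costs of at least [g], whose sum is unbounded. *)
pose g := (c 0%N + e 1%N - r) / K.
have g0 : 0 < g by rewrite divr_gt0 // subr_gt0.
have c_ge n : g <= c n.+1.
  rewrite ler_pdivrMr // mulrC (le_trans _ (eK n.+1)) // lerBlDl.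
  by apply: le_trans (telescope n) _; rewrite lerD2r -lee_fin le_r.
have sum_ge n : g * n%:R <= \sum_(0 <= k < n.+1) c k.
  elim: n => [|n IH]; first by rewrite mulr0 big_nat1.
  by rewrite big_nat_recr //= -natr1 mulrDr mulr1 lerD.
have := archi_boundP (divr_ge0 r0 (ltW g0)); rewrite ltr_pdivrMr // mulrC.
by apply/negP; rewrite -leNgt (le_trans (sum_ge _)) // -lee_fin le_r.
Qed.

(** The inequalities telescope and the nonnegative remainder is dropped. The set [D], closed under
    [mu], confines the process to nodes where they hold: the Bellman equation for [V] is available
    only at connected nodes. *)
Lemma total_cost_le w (mu : control_map S) (D : state S -> Prop) x :
  (forall y, 0 <= w y) ->
  (forall i, D (Some i) -> lookahead w (mu i) <= w (Some i)) ->
  (forall i y, D (Some i) -> 0 < trans (mu i) y -> D y) ->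
  D x -> (total_cost P Y x (stationary mu) <= (w x)%:E)%E.
Proof.
move=> w0 w_ge D_closed Dx; rewrite /total_cost (total_cost_mean (process_Y _ _)).
pose c k := mean (stationary mu) x k (stage_cost mu).
pose e k := mean (stationary mu) x k w.
have c0 k : 0 <= c k by apply: mean_ge0 => y; exact: stage_cost_ge0.
have support n y : law (stationary mu) x n y != 0 -> D y.
  elim: n y => [|n IH] z /=; first by rewrite pnatr_eq0 eqb0 negbK => /eqP ->.
  apply: contraNP => nDz; apply/eqP/big1 => y _.
  have [->|/IH Dy] := eqVneq (law (stationary mu) x n y) 0; first by rewrite mul0r.
  suff -> : step_prob mu y z = 0 by rewrite mulr0.
  case: y Dy => [i|] Dy /=; last by case: eqP => // zt; rewrite zt in nDz.
  apply/eqP; rewrite eq_le trans_ge0 andbT leNgt; apply/negP => pz.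
  exact/nDz/(D_closed i).
have e_step k : c k + e k.+1 <= e k.
  rewrite /c /e meanS -meanD; apply: le_mean => -[i|] /support Dy.
    exact: w_ge.
  rewrite add0r (bigD1 (target S)) //= big1 ?addr0 ?mul1r //.
  by move=> z /negbTE ->; rewrite mul0r.
have telescope n : \sum_(0 <= k < n) c k + e n <= w x.
  elim: n => [|n IH]; first by rewrite big_geq // add0r /e mean0.
  by rewrite big_nat_recr //= -addrA (le_trans _ IH) // lerD2l.
apply: lime_le.
  by apply: is_cvg_nneseries => k _ _; rewrite lee_fin; exact: c0.
apply: nearW => n; rewrite sumEFin lee_fin.
by apply: le_trans (telescope n); rewrite lerDl mean_ge0.
Qed.

(** The lower bound by subsolutions applies with an arbitrary height at the disconnected nodes. *)
Lemma total_cost_nonreaching x pi : ~~ reaching x -> total_cost P Y x pi = +oo%E.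
Proof.
case: x => [i|] xt; last by rewrite /reaching connect0 in xt.
apply/eqyP => N N0; have wS := @subsolution_nonreaching R S N (ltW N0).
apply: le_trans (total_cost_ge_lookahead pi i wS); rewrite lee_fin.
by have [_ _ /(_ _ (pi 0%N i))] := wS; rewrite (negbTE xt).
Qed.

(** From a disconnected node no connected node ever gets positive mass, so hitting the target is a
    countable union of null events. *)
Lemma Xc_reaching x : Xc P Y x -> reaching x.
Proof.
move=> [pi]; apply: contraPT => xt; apply/eqP.
have law0 n y : reaching y -> law pi x n y = 0.
  elim: n y => [|n IH] z zt /=.
    by case: eqP => // zx; move: xt; rewrite -zx zt.
  apply: big1 => y _; have [/IH ->|] := boolP (reaching y); first by rewrite mul0r.
  case: y => [i|] yt /=; last by rewrite /reaching connect0 in yt.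
  suff -> : trans (pi n i) z = 0 by rewrite mulr0.
  apply/eqP; rewrite eq_le trans_ge0 andbT leNgt; apply/negP => pz.
  by move: yt; rewrite (trans_reaching pz zt).
have never k : P.-negligible [set w | Y pi x k w = target S].
  apply/negligibleP; first exact: measurable_state (process_Y pi x) _ _.
  apply: etrans (state_law (process_Y pi x) k (target S)) _.
  by rewrite law0 // /reaching connect0.
rewrite (_ : mkset _ = \bigcup_k [set w | Y pi x k w = target S]).
  rewrite measure_negligible ?(eq_sym 0%E) ?onee_eq0 //; last exact: negligible_bigcup.
  by apply: bigcup_measurable => k _; exact: measurable_state (process_Y pi x) _ _.
by apply/seteqP; split=> w [k]; [| move=> _] => kt; exists k.
Qed.

(** Two functions are at work: [V] is finite everywhere, as the weights in mode causality must be,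
    while [U] is infinite at disconnected nodes and is the value function. *)
Lemma causal_mssp (Delta : R) : 0 <= Delta ->
  (forall (i : 'I_(nnodes S)) (m : 'I_(nmodes i)),
    mode_absolutely_delta_causal m Delta) ->
  absolutely_delta_causal P Y Delta /\
  exists U : state S -> \bar R,
  [/\ U (target S) = 0%E, forall y, (0 <= U y)%E,
      forall i (a : control i), (U (Some i) <= backup U a)%E,
      forall i, (U (Some i) < +oo)%E -> exists2 a : control i,
        backup U a = U (Some i) &
        forall y, 0 < trans a y -> (U y + Delta%:E < U (Some i))%E &
      forall y, value P Y y = U y].
Proof.
move=> Delta0 causal; have [N [V [VS V_lt V_N V_opt]]] := @bellman_solution R S.
have [V_t V0 V_le] := VS.
(* A disconnected successor would have [V] equal to [N], above [V (Some i)]. *)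
have opt_causal i (a : control i) y : reaching (Some i) ->
    lookahead V a = V (Some i) -> 0 < trans a y ->
    V y + Delta < V (Some i) /\ reaching y.
  move=> it aV py; have lt_y : V y + Delta < V (Some i).
    by rewrite -aV; apply: causal_minimizer py => // a'; rewrite aV.
  split=> //; apply/negPn/negP => /V_N VyN.
  have := lt_trans lt_y (V_lt _ it).
  by rewrite VyN -ltrBrDl subrr ltNge Delta0.
pose U y := if reaching y then (V y)%:E else +oo%E.
have U_t : U (target S) = 0%E by rewrite /U /reaching connect0 V_t.
have U_reach y : reaching y -> U y = (V y)%:E by rewrite /U => ->.
have [mu mu_opt] : exists mu : control_map S, forall i, reaching (Some i) ->
    lookahead V (mu i) = V (Some i).
  have pick i : exists a : control i, reaching (Some i) -> lookahead V a = V (Some i).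
    have [/V_opt[a aV]|_] := boolP (reaching (Some i)); first by exists a.
    by have [a _] := lookahead_minimum i V; exists a.
  by exists (fun i => sval (cid (pick i))) => i; exact: (svalP (cid (pick i))).
have V_le_cost pi y : ((V y)%:E <= total_cost P Y y pi)%E.
  case: y => [i|]; last first.
    rewrite -[None]/(target S) V_t; apply: integral_ge0 => w _.
    by apply: nneseries_ge0 => k _ _; rewrite lee_fin stage_cost_ge0.
  by apply: le_trans (total_cost_ge_lookahead pi i VS); rewrite lee_fin.
have valueU y : value P Y y = U y.
  apply/eqP; rewrite eq_le; apply/andP; split; last first.
    apply: le_ereal_inf_tmp => _ [pi _ <-]; rewrite /U.
    by case: ifPn => [_|yt]; [exact: V_le_cost | rewrite total_cost_nonreaching].
  rewrite /U; case: ifPn => [yt|_]; last exact: leey.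
  apply: ge_ereal_inf; exists (total_cost P Y y (stationary mu)).
    by exists (stationary mu).
  apply: (@total_cost_le V mu (fun z => reaching z)) => // [i it|i z it pz].
    by rewrite mu_opt.
  by have [] := opt_causal i (mu i) z it (mu_opt i it) pz.
split.
  move=> nu nu_opt i /Xc_reaching it y py.
  (* The cost of [nu] is at least the lookahead of its first control, and it equals [V (Some i)] by
     optimality. *)
  have nuV : lookahead V (nu i) = V (Some i).
    apply/eqP; rewrite eq_le V_le andbT -lee_fin -U_reach // -valueU -nu_opt.
    exact: (total_cost_ge_lookahead (stationary nu)).
  have [lt_y yt] := opt_causal i (nu i) y it nuV py.
  by rewrite !valueU !U_reach // -EFinD lte_fin.
exists U; split=> // [y|i a|i].
- by rewrite /U; case: ifP => // _; rewrite lee_fin.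
- rewrite {1}/U; case: ifPn => [it|it].
    apply: le_trans (le_lookahead_backup a (_ : forall y, ((V y)%:E <= U y)%E)).
      by rewrite lee_fin.
    by move=> y; rewrite /U; case: ifP => // _; exact: leey.
  suff -> : backup U a = +oo%E by [].
  (* [U] dominates the subsolution of height [M], so the backup is at least [M], for every positive
     [M]. *)
  apply/eqyP => M M0; have [_ _ /(_ i a)] := @subsolution_nonreaching R S M (ltW M0).
  rewrite (negbTE it) -lee_fin => /le_trans; apply; apply: le_lookahead_backup => y.
  by rewrite /U; case: ifP => // _; [rewrite lee_fin | exact: leey].
- rewrite {1}/U; case: ifP => // it _; have [a aV] := V_opt i it.
  exists a => [|y py]; last first.
    by have [lt_y yt] := opt_causal i a y it aV py; rewrite !U_reach // -EFinD lte_fin.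
  rewrite U_reach // -aV /lookahead EFinD -sumEFin; congr (_ + _)%E.
  apply: eq_bigr => y _; have [py|py] := ltP 0 (trans a y).
    by have [_ yt] := opt_causal i a y it aV py; rewrite U_reach.
  (* The convention [0 * +oo = 0] discards impossible transitions to disconnected nodes. *)
  have -> : trans a y = 0 by apply/eqP; rewrite eq_le py trans_ge0.
  by rewrite mul0e mul0r.
Qed.

End Verification.

Theorem corollary3p1 (R : realType) (S : mssp R)
    (d : measure_display) (Omega : measurableType d) (P : probability Omega R)
    (Y : policy S -> state S -> nat -> Omega -> state S)
    (process_Y : forall (pi : policy S) (x : state S),
       controlled_process P pi x (Y pi x)) :
  ((forall (i : 'I_(nnodes S)) (m : 'I_(nmodes i)), mode_absolutely_causal m) ->
     absolutely_causal P Y /\ dijkstra_applicable P Y) /\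
  (forall (delta : forall i : 'I_(nnodes S), 'I_(nmodes i) -> R) (Delta : R),
     (forall (i : 'I_(nnodes S)) (m : 'I_(nmodes i)), 0 <= delta i m) ->
     (forall (i : 'I_(nnodes S)) (m : 'I_(nmodes i)),
        mode_absolutely_delta_causal m (delta i m)) ->
     is_min_over_modes delta Delta ->
     absolutely_delta_causal P Y Delta /\
     (0 < Delta -> dial_applicable P Y Delta)).
Proof.
split=> [causal|delta Delta delta0 causal [[i0 [m0 deltaE]] Delta_min]].
  have [? [U [U_t U0 U_le U_opt valueU]]] := causal_mssp process_Y (lexx 0) causal.
  split=> //; apply: (sound_applicable _ _ U_opt valueU) => // c c'.
  exact: (dijkstra_sound (lexx 0) U_t U_le U_opt).
have Delta_ge0 : 0 <= Delta by rewrite -deltaE.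
have Delta_causal (i : 'I_(nnodes S)) (m : 'I_(nmodes i)) :
    mode_absolutely_delta_causal m Delta.
  (* Causality passes to smaller constants. *)
  move=> W W0 xi xi_min j xij.
  by have := causal i m W W0 xi xi_min j xij; apply: le_lt_trans; rewrite lerD2l.
have [? [U [U_t U0 U_le U_opt valueU]]] :=
  causal_mssp process_Y Delta_ge0 Delta_causal.
split=> // Delta0; apply: (sound_applicable _ _ U_opt valueU) => // c c'.
exact: (dial_sound Delta_ge0 U_t U0 U_le U_opt Delta0).
Qed.
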